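(* Let $C\in S^n$ with $C\succeq 0$, $b\in\mathbb{R}^m$, and let $\mathcal{A}:S^n\to\mathbb{R}^m$ be a linear operator, such that both the problem $\min_X\{\langle C,X\rangle : \mathcal{A}X=b,\ X\succeq 0\}$ and its Lagrange dual $\max_y\{b^\top y : C-\mathcal{A}^\top y\succeq 0\}$ have optimal solutions. Consider the gauge optimization problem (GP) and its gauge dual problem (GD): $$\text{(GP)}\quad \min_{X\in S^n}\{\kappa(X) : \mathcal{A}X=b\},\qquad \text{(GD)}\quad \min_{y\in\mathbb{R}^m}\{\kappa^\circ(\mathcal{A}^\top y) : b^\top y\geq 1\}.$$ Let $y^*\in\mathbb{R}^m$ be any optimal solution of (GD). If $X^*\in S^n$ is optimal for (GP), then $\mathcal{A}X^*=b$ and $X^*=U_2TU_2^\top$ for some $T\succeq 0$. Here $U_2\in\mathbb{R}^{n\times r}$ is an orthonormal basis of the null space of $\mu_{y^*}C-\mathcal{A}^\top y^*$, where $\mu_{y^*}:=\kappa^\circ(\mathcal{A}^\top y^* )$. Therefore, $X^*$ can be recovered from $y^*$ via $X^*=U_2T^*U_2^\top$ with $T^*\in\arg\min_{T\succeq 0}\|\mathcal{A}(U_2TU_2^\top)-b\|_2$.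
   Context: $S^n$ is the space of real symmetric $n\times n$ matrices with inner product $\langle A,B\rangle=\operatorname{tr}(AB)$; $X\succeq 0$ means $X$ is symmetric positive semidefinite (for $T$, of size $r\times r$, where $r$ is the dimension of the null space of $\mu_{y^*}C-\mathcal{A}^\top y^*$). That $U_2$ is an orthonormal basis of this null space means that its columns form such a basis. $\mathcal{A}^\top:\mathbb{R}^m\to S^n$ is the adjoint of $\mathcal{A}$, and $\|\cdot\|_2$ is the Euclidean norm on $\mathbb{R}^m$. The gauge function $\kappa$ is defined by $\kappa(X)=\langle C,X\rangle$ if $X\succeq 0$ and $\kappa(X)=+\infty$ otherwise. Its polar function is $\kappa^\circ(Z)=\inf\{\mu\geq 0 : \mu C-Z\succeq 0\}$ for $Z\in S^n$ (with $\inf\emptyset=+\infty$).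
   Formalization: The formal theorem additionally assumes that the optimal values of the primal problem and its Lagrange dual coincide (zero duality gap); existence of optimal solutions to both does not imply this, and the claim fails when there is a gap. *)

(* Defs.v *)
From HB Require Import structures.
From mathcomp Require Import all_boot all_order all_algebra.
From mathcomp Require Import all_classical all_reals ereal.

Set Implicit Arguments.
Unset Strict Implicit.
Unset Printing Implicit Defensive.

Import Order.TTheory GRing.Theory Num.Theory.
Local Open Scope ring_scope.
Local Open Scope classical_set_scope.

Section SymmetricMatrices.
Variables (R : realType) (n : nat).

Lemma symmetricmxP (X : 'M[R]_n) : reflect (X^T = X) (X \is symmetricmx).
Proof.
apply: (iffP (is_hermitianmxP _ _ _)); rewrite expr0 scale1r map_mx_id //.
Qed.

Definition symmx_pred : {pred 'M[R]_n} := fun X => X \is symmetricmx.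

Lemma symmx_submod_closed : submod_closed symmx_pred.
Proof.
split=> [|a X Y /symmetricmxP sX /symmetricmxP sY]; apply/symmetricmxP.
  by rewrite trmx0.
by rewrite linearP /= sX sY.
Qed.

HB.instance Definition _ :=
  GRing.isSubmodClosed.Build R 'M[R]_n symmx_pred symmx_submod_closed.

Record symmx := SymMx { mx_of_sym :> 'M[R]_n; _ : symmx_pred mx_of_sym }.

HB.instance Definition _ := [isSub for mx_of_sym].
HB.instance Definition _ := [Choice of symmx by <:].
HB.instance Definition _ := [SubChoice_isSubLmodule of symmx by <:].

Lemma mx_of_sym_is_linear : linear mx_of_sym.
Proof. by []. Qed.

HB.instance Definition _ :=
  GRing.isLinear.Build R symmx 'M[R]_n *:%R mx_of_sym mx_of_sym_is_linear.

Lemma trmx_symmx (X : symmx) : (X : 'M[R]_n)^T = X.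
Proof. by apply/symmetricmxP; case: X. Qed.

Definition inner_symmx (X Y : symmx) : R := \tr ((X : 'M[R]_n) *m Y).

Definition psd (X : symmx) : Prop :=
  forall v : 'cV[R]_n, 0 <= (v^T *m X *m v) 0 0.

End SymmetricMatrices.

Section EuclideanSpace.
Variables (R : realType) (m : nat).

Definition dotv (u v : 'cV[R]_m) : R := (u^T *m v) 0 0.

Definition norm2 (v : 'cV[R]_m) : R := Num.sqrt (dotv v v).

End EuclideanSpace.

Section Congruence.
Variables (R : realType) (n r : nat) (U : 'M[R]_(n, r)) (T : symmx R r).

Lemma sym_congr_subproof : U *m T *m U^T \is symmetricmx.
Proof.
by apply/symmetricmxP; rewrite !trmx_mul trmxK trmx_symmx mulmxA.
Qed.

Definition sym_congr : symmx R n := SymMx sym_congr_subproof.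

End Congruence.

Section Adjoint.
Variables (R : realType) (n m : nat) (A : {linear symmx R n -> 'cV[R]_m}).

Lemma sym_delta_subproof (i j : 'I_n) :
  2^-1 *: (delta_mx i j + delta_mx j i : 'M[R]_n) \is symmetricmx.
Proof.
by apply/symmetricmxP; rewrite linearZ linearD /= !trmx_delta addrC.
Qed.

Definition sym_delta i j : symmx R n := SymMx (sym_delta_subproof i j).

Lemma sym_deltaC i j : sym_delta i j = sym_delta j i.
Proof. by apply: val_inj; rewrite /= addrC. Qed.

Lemma adjoint_subproof (y : 'cV[R]_m) :
  \matrix_(i, j) dotv y (A (sym_delta i j)) \is symmetricmx.
Proof. by apply/symmetricmxP/matrixP=> i j; rewrite !mxE sym_deltaC. Qed.

(* The entries are forced: <Z, sym_delta i j> = Z i j for symmetric Z. *)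
Definition adjoint (y : 'cV[R]_m) : symmx R n := SymMx (adjoint_subproof y).

Lemma symmx_sum_delta (X : symmx R n) :
  X = \sum_i \sum_j (X : 'M[R]_n) i j *: sym_delta i j.
Proof.
apply: val_inj; rewrite raddf_sum /=.
have -> : \sum_i mx_of_sym (\sum_j (X : 'M[R]_n) i j *: sym_delta i j) =
  2^-1 *: (\sum_i \sum_j (X : 'M[R]_n) i j *: delta_mx i j +
           \sum_i \sum_j (X : 'M[R]_n) i j *: delta_mx j i).
  rewrite -big_split /= scaler_sumr; apply: eq_bigr => i _.
  rewrite raddf_sum -big_split /= scaler_sumr; apply: eq_bigr => j _.
  by rewrite -scalerDr scalerA mulrC -scalerA.
have -> : \sum_i \sum_j (X : 'M[R]_n) i j *: delta_mx j i = X :> 'M[R]_n.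
  rewrite exchange_big /= [RHS]matrix_sum_delta.
  apply: eq_bigr => i _; apply: eq_bigr => j _.
  by rewrite -[in LHS](trmx_symmx X) mxE.
by rewrite -matrix_sum_delta -mulr2n -scaler_nat scalerA mulVf ?scale1r ?pnatr_eq0.
Qed.

Lemma adjointP (y : 'cV[R]_m) (X : symmx R n) :
  inner_symmx (adjoint y) X = dotv y (A X).
Proof.
rewrite {2}(symmx_sum_delta X) raddf_sum /dotv mulmx_sumr summxE.
rewrite /inner_symmx /mxtrace; apply: eq_bigr => i _.
rewrite raddf_sum mulmx_sumr summxE mxE; apply: eq_bigr => j _.
by rewrite /= linearZ -scalemxAr [RHS]mxE [(adjoint y : 'M_n) i j]mxE mulrC -{1}(trmx_symmx X) mxE.
Qed.

End Adjoint.

Section OrthonormalBasis.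
Variables (R : realType) (n : nat).

Definition null_space (S : 'M[R]_n) : set 'cV[R]_n := [set v | S *m v = 0].

(* The columns of U are an orthonormal family whose span is V. *)
Definition orthonormal_basis (V : set 'cV[R]_n) (r : nat) (U : 'M[R]_(n, r)) :=
  U^T *m U = 1%:M /\ V = range (fun w : 'cV[R]_r => U *m w).

End OrthonormalBasis.

Section Optimality.
Variables (R : realType) (V : Type).
Local Open Scope ereal_scope.

(* Objectives are extended-real valued; an optimal solution is required to have
   a finite objective value, so a problem equal to +oo on its whole feasible set
   has none. *)
Definition minimizer (D : set V) (f : V -> \bar R) (x : V) : Prop :=
  [/\ D x, f x \is a fin_num & forall z, D z -> f x <= f z].

Definition maximizer (D : set V) (f : V -> \bar R) (x : V) : Prop :=
  [/\ D x, f x \is a fin_num & forall z, D z -> f z <= f x].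

End Optimality.

Section GaugeDuality.
Variables (R : realType) (n m : nat).
Variables (C : symmx R n) (b : 'cV[R]_m) (A : {linear symmx R n -> 'cV[R]_m}).

Definition gauge (X : symmx R n) : \bar R :=
  if `[< psd X >] then (inner_symmx C X)%:E else +oo%E.

Definition gauge_polar (Z : symmx R n) : \bar R :=
  ereal_inf [set mu%:E | mu in [set mu : R | 0 <= mu /\ psd (mu *: C - Z)]].

Definition primal_optimal : symmx R n -> Prop :=
  minimizer [set X | A X = b /\ psd X] (fun X => (inner_symmx C X)%:E).

Definition dual_optimal : 'cV[R]_m -> Prop :=
  maximizer [set y | psd (C - adjoint A y)] (fun y => (dotv b y)%:E).

Definition gp_optimal : symmx R n -> Prop :=
  minimizer [set X | A X = b] gauge.

Definition gd_optimal : 'cV[R]_m -> Prop :=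
  minimizer [set y | 1 <= dotv b y] (fun y => gauge_polar (adjoint A y)).

Definition residual_optimal (r : nat) (U : 'M[R]_(n, r)) : symmx R r -> Prop :=
  minimizer [set T | psd T] (fun T => (norm2 (A (sym_congr U T) - b))%:E).

(* For semidefinite programs this is not implied by attainment of both the
   primal and the dual, and complementarity of gauge-dual solutions needs it. *)
Definition zero_duality_gap : Prop :=
  forall X y, primal_optimal X -> dual_optimal y -> inner_symmx C X = dotv b y.

End GaugeDuality.

(* Main.v *)
(* The optimal values of (GP) and (GD) are reciprocal, so the slack matrix
   S = mu C - A^T ystar and Xstar are positive semidefinite with <S, Xstar> = 0.
   Since a positive semidefinite matrix is a sum of outer products w w^T, this
   forces S Xstar = 0: the columns of Xstar lie in the span of U2.  Conversely a
   zero-residual T gives <S, U2 T U2^T> = 0, i.e. <C, U2 T U2^T> = 1 / mu, the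
   optimal value of (GP). *)

Require Import Defs.
From mathcomp Require Import all_boot all_order all_algebra.
From mathcomp Require Import all_classical all_reals ereal.
From mathcomp Require Import ring lra.

Set Implicit Arguments.
Unset Strict Implicit.
Unset Printing Implicit Defensive.

Import Order.TTheory GRing.Theory Num.Theory.
Local Open Scope ring_scope.

(** * Quadratic forms and positive semidefinite matrices *)

Section PsdForms.
Variables (R : realType) (n : nat).
Implicit Types (S X : symmx R n) (u v w : 'cV[R]_n).

Definition bform (M : 'M[R]_n) u v : R := (u^T *m M *m v) 0 0.

Lemma bformC X u v : bform X u v = bform X v u.
Proof.
have -> : bform X u v = (u^T *m X *m v)^T 0 0 by rewrite mxE.
by rewrite !trmx_mul trmxK trmx_symmx mulmxA.
Qed.

Lemma bform_lincomb X u v t :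
  bform X (u - t *: v) (u - t *: v) =
  bform X u u - 2 * t * bform X u v + t ^+ 2 * bform X v v.
Proof.
have -> : bform X (u - t *: v) (u - t *: v) = bform X u u - t * bform X u v
    - t * bform X v u + t ^+ 2 * bform X v v.
  rewrite /bform.
  have -> : (u - t *: v)^T = u^T - t *: v^T by rewrite linearB linearZ.
  rewrite !mulmxBl !mulmxBr -!scalemxAl -!scalemxAr.
  by rewrite !mxE; ring.
by rewrite (bformC X v u); ring.
Qed.

Lemma bform_subM (M N : 'M[R]_n) u v : bform (M - N) u v = bform M u v - bform N u v.
Proof. by rewrite /bform mulmxBr mulmxBl !mxE. Qed.

Lemma bform_scaleM a (M : 'M[R]_n) u v : bform (a *: M) u v = a * bform M u v.
Proof. by rewrite /bform -scalemxAr -scalemxAl !mxE. Qed.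

Lemma bform_delta (M : 'M[R]_n) i j : bform M (delta_mx i 0) (delta_mx j 0) = M i j.
Proof. by rewrite /bform trmx_delta -rowE -colE !mxE. Qed.

Lemma dotv_eq0 (m : nat) (x : 'cV[R]_m) : (dotv x x == 0) = (x == 0).
Proof.
rewrite /dotv mxE psumr_eq0 => [|i _]; last by rewrite mxE -expr2 sqr_ge0.
apply/allP/eqP => [x0|-> i _]; last by rewrite /= !mxE mul0r eqxx.
apply/matrixP => i j; rewrite ord1 [RHS]mxE; apply/eqP.
by have := x0 i (mem_index_enum i); rewrite mxE -expr2 sqrf_eq0.
Qed.

Lemma psd_isotropic X v : psd X -> bform X v v = 0 -> (X : 'M_n) *m v = 0.
Proof.
move=> Xpsd v0; apply/eqP; rewrite -dotv_eq0; apply/negPn/negP => d0.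
(* with u = X v, the form at u - t v is affine in t and equals -1 for this t *)
set u := _ *m v in d0; set d := dotv u u in d0.
have uvd : bform X u v = d by rewrite /bform -mulmxA.
have := Xpsd (u - ((bform X u u + 1) / (2 * d)) *: v); apply/negP.
rewrite -/(bform _ _ _) bform_lincomb v0 uvd -ltNge.
have -> : 2 * ((bform X u u + 1) / (2 * d)) * d = bform X u u + 1 by field.
lra.
Qed.

Lemma psd_diag X i : psd X -> 0 <= (X : 'M_n) i i.
Proof. by move=> Xpsd; rewrite -bform_delta; exact: Xpsd. Qed.

Lemma outer_sym v : v *m v^T \is symmetricmx.
Proof. by apply/symmetricmxP; rewrite trmx_mul trmxK. Qed.

Definition outer v : symmx R n := SymMx (outer_sym v).

Lemma bform_outer v u : bform (outer v) u u = (dotv u v) ^+ 2.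
Proof.
rewrite /bform /= /dotv mulmxA -mulmxA [LHS]mxE big_ord1 expr2; congr (_ * _).
by rewrite -[v^T *m u]trmxK mxE trmx_mul trmxK.
Qed.

(** One elimination step of the Cholesky factorization: subtracting this rank-one matrix clears row
    and column [i] of [X]. *)
Lemma schur_psd X i (v := (X : 'M_n) *m delta_mx i 0) :
  psd X -> 0 < (X : 'M_n) i i -> psd (X - ((X : 'M_n) i i)^-1 *: outer v).
Proof.
move=> Xpsd xi u; rewrite -/(bform _ _ _).
change (0 <= bform ((X : 'M_n) - ((X : 'M_n) i i)^-1 *: (outer v : 'M_n)) u u).
rewrite bform_subM bform_scaleM bform_outer.
(* this point minimizes the form of X along the line u + R e_i *)
have := Xpsd (u - (dotv u v / (X : 'M_n) i i) *: delta_mx i 0).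
rewrite -/(bform _ _ _) bform_lincomb bform_delta.
have -> : bform X u (delta_mx i 0) = dotv u v by rewrite /bform -mulmxA.
suff -> : bform X u u - 2 * (dotv u v / (X : 'M_n) i i) * dotv u v
  + (dotv u v / (X : 'M_n) i i) ^+ 2 * (X : 'M_n) i i =
  bform X u u - ((X : 'M_n) i i)^-1 * dotv u v ^+ 2 by [].
by field; rewrite gt_eqF.
Qed.

(** By induction on the number of nonzero diagonal entries, each elimination step splitting off one
    outer product. *)
Lemma psd_sum_outer X : psd X ->
  exists ws : seq 'cV[R]_n, X = \sum_(w <- ws) outer w.
Proof.
have [k] := ubnP #|[pred i | (X : 'M_n) i i != 0]|.
elim: k X => // k IHk X; rewrite ltnS => ltk Xpsd.
have [i /= xi0|X0] := pickP [pred i | (X : 'M_n) i i != 0]; last first.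
  (* A zero diagonal makes every basis vector isotropic, so [X] kills them all. *)
  exists [::]; rewrite big_nil; apply: val_inj => /=; apply/matrixP => i j.
  rewrite [RHS]mxE -[LHS]bform_delta bformC /bform -mulmxA psd_isotropic ?mulmx0 ?mxE//.
  by rewrite bform_delta; have /negbFE/eqP := X0 i.
have xi : 0 < (X : 'M_n) i i by rewrite lt_def xi0 psd_diag.
have Ypsd := schur_psd Xpsd xi.
set v := _ *m _ in Ypsd; set Y := (_ - _) in Ypsd.
have Yjj j : (Y : 'M_n) j j = (X : 'M_n) j j - ((X : 'M_n) i i)^-1 * v j 0 ^+ 2.
  change ((Y : 'M_n) j j) with
    (((X : 'M_n) - ((X : 'M_n) i i)^-1 *: (v *m v^T)) j j).
  by rewrite 3!mxE; congr (_ - _ * _); rewrite [LHS]mxE big_ord1 [_^T _ _]mxE expr2.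
have [|ws Yws] := IHk Y _ Ypsd.
  (* A zero diagonal entry of [X] can only decrease, yet stays nonnegative in [Y], so it remains
     zero; entry [i] becomes zero as well. *)
  apply: leq_trans ltk; apply/proper_card/fintype.properP; split.
    apply/fintype.subsetP => j; rewrite !inE; apply: contra => /eqP xj.
    rewrite eq_le psd_diag// andbT Yjj xj sub0r.
    by rewrite oppr_le0 mulr_ge0 ?sqr_ge0 ?invr_ge0 ?ltW.
  by exists i; rewrite !inE// negbK Yjj /v -colE mxE expr2 mulKf// subrr.
exists ((Num.sqrt ((X : 'M_n) i i)^-1 *: v) :: ws).
rewrite big_cons -Yws; suff -> : outer (Num.sqrt ((X : 'M_n) i i)^-1 *: v) =
    ((X : 'M_n) i i)^-1 *: outer v by rewrite addrC subrK.
apply: val_inj => /=; rewrite linearZ -scalemxAl -scalemxAr scalerA -expr2.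
by rewrite sqr_sqrtr// invr_ge0 ltW.
Qed.

Lemma inner_outer S w : inner_symmx S (outer w) = bform S w w.
Proof.
by rewrite /inner_symmx /= mulmxA mxtrace_mulC mulmxA /mxtrace big_ord1.
Qed.

Lemma inner_sum_outer S ws :
  inner_symmx S (\sum_(w <- ws) outer w) = \sum_(w <- ws) bform S w w.
Proof.
rewrite /inner_symmx raddf_sum mulmx_sumr raddf_sum.
by apply: eq_bigr => w _; exact: inner_outer.
Qed.

Lemma inner_psd_ge0 S X : psd S -> psd X -> 0 <= inner_symmx S X.
Proof.
move=> Spsd /psd_sum_outer[ws ->]; rewrite inner_sum_outer.
by apply: sumr_ge0 => w _; exact: Spsd.
Qed.

(** With [X] a sum of outer products of vectors [w], the inner product is a sum of nonnegative
    values of the form of [S]; all vanish, so every [w] is isotropic for [S]. *)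
Lemma inner_psd_eq0 S X : psd S -> psd X -> inner_symmx S X = 0 ->
  (S : 'M_n) *m X = 0.
Proof.
move=> Spsd /psd_sum_outer[ws ->]; rewrite inner_sum_outer => /eqP.
rewrite psumr_eq0 => [/allP ws0|w _]; last exact: Spsd.
rewrite raddf_sum mulmx_sumr big_seq big1// => w /ws0/eqP Sw.
by rewrite mulmxA psd_isotropic// mul0mx.
Qed.

End PsdForms.

(** * The gauge, and attainment of the infimum in its polar *)

Lemma inner_pencil (R : realType) (n : nat) (C Z X : symmx R n) (mu : R) :
  inner_symmx (mu *: C - Z) X = mu * inner_symmx C X - inner_symmx Z X.
Proof.
change (\tr ((mu *: (C : 'M_n) - Z) *m X) =
  mu * \tr ((C : 'M_n) *m X) - \tr ((Z : 'M_n) *m X)).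
by rewrite mulmxBl -scalemxAl linearB linearZ.
Qed.

Lemma bform_pencil (R : realType) (n : nat) (C Z : symmx R n) (mu : R) u v :
  bform (mu *: C - Z : symmx R n) u v = mu * bform C u v - bform Z u v.
Proof.
change (bform (mu *: (C : 'M_n) - Z) u v = mu * bform C u v - bform Z u v).
by rewrite bform_subM bform_scaleM.
Qed.

(** The feasible multipliers form a closed set: for each [v] the constraint is a weak affine
    inequality in [mu], and a violation at [mu] would persist slightly beyond it. *)
Lemma gauge_polar_attained (R : realType) (n : nat) (C Z : symmx R n) (mu : R) :
  psd C -> gauge_polar C Z = mu%:E -> 0 <= mu /\ psd (mu *: C - Z).
Proof.
move=> Cpsd muE; split.
  rewrite -lee_fin -muE; apply: le_ereal_inf_tmp => _ [k [k0 _] <-].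
  by rewrite lee_fin.
move=> v; rewrite -/(bform _ _ _) bform_pencil leNgt; apply/negP => lt0.
have c0 : 0 <= bform C v v by exact: Cpsd.
(* Adding 1 to the denominator covers a vanishing form and keeps [e * bform C v v] strictly below
   the deficit, so every [k < mu + e] is infeasible. *)
pose e := - (mu * bform C v v - bform Z v v) / (bform C v v + 1).
have e0 : 0 < e by apply: divr_gt0; lra.
have : (gauge_polar C Z < (mu + e)%R%:E)%E by rewrite muE lte_fin ltrDl.
move=> /ereal_inf_lt[_ [k [_ kpsd] <-]]; rewrite lte_fin => ke.
have := kpsd v; rewrite -/(bform _ _ _) bform_pencil.
have : k * bform C v v <= (mu + e) * bform C v v by rewrite ler_wpM2r// ltW.
have : e * (bform C v v + 1) = - (mu * bform C v v - bform Z v v).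
  by rewrite /e divfK// gt_eqF//; lra.
nra.
Qed.

Lemma gauge_fin_num (R : realType) (n : nat) (C X : symmx R n) :
  gauge C X \is a fin_num -> psd X.
Proof. by rewrite /gauge; case: ifPn => // /asboolP. Qed.

Lemma gauge_psd (R : realType) (n : nat) (C X : symmx R n) :
  psd X -> gauge C X = (inner_symmx C X)%:E.
Proof. by move=> Xpsd; rewrite /gauge asboolT. Qed.

(** Finiteness of the optimal gauge value forces [X] into the cone, where the two objectives
    coincide. *)
Lemma gp_optimal_primal (R : realType) (n m : nat) (C : symmx R n) (b : 'cV[R]_m)
    (A : {linear symmx R n -> 'cV[R]_m}) (X : symmx R n) :
  gp_optimal C b A X -> psd X /\ primal_optimal C b A X.
Proof.
case=> /= AX /gauge_fin_num Xpsd Xmin; split=> //; split=> //= Z [AZ Zpsd].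
by rewrite -(gauge_psd C Xpsd) -(gauge_psd C Zpsd); exact: Xmin.
Qed.

(** * Congruences, residual norm and the null space of the slack matrix *)

Lemma psd_scale (R : realType) (n : nat) (X : symmx R n) (a : R) :
  0 <= a -> psd X -> psd (a *: X).
Proof.
move=> a0 Xpsd v; change (0 <= bform (a *: (X : 'M_n)) v v).
by rewrite bform_scaleM mulr_ge0//; exact: Xpsd.
Qed.

Lemma psd_congr (R : realType) (n r : nat) (U : 'M[R]_(n, r)) (T : symmx R r) :
  psd T -> psd (sym_congr U T).
Proof.
move=> Tpsd v; have := Tpsd (U^T *m v); rewrite trmx_mul trmxK.
by rewrite /= !mulmxA.
Qed.

Lemma norm2_ge0 (R : realType) (m : nat) (v : 'cV[R]_m) : 0 <= norm2 v.
Proof. exact: sqrtr_ge0. Qed.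

Lemma norm2_eq0 (R : realType) (m : nat) (v : 'cV[R]_m) : (norm2 v == 0) = (v == 0).
Proof.
rewrite -dotv_eq0 /norm2 sqrtr_eq0 eq_le; apply/esym/andb_idr => _.
by rewrite /dotv mxE; apply: sumr_ge0 => i _; rewrite mxE -expr2 sqr_ge0.
Qed.

Lemma dotvC (R : realType) (m : nat) (u v : 'cV[R]_m) : dotv u v = dotv v u.
Proof. by rewrite /dotv -[u^T *m v]trmxK mxE trmx_mul trmxK. Qed.

(** The columns of [X] lie in the range of [U], which the projector [U *m U^T] fixes; transposing
    gives the same on the right. *)
Lemma annihilated_congr (R : realType) (n r : nat) (S X : symmx R n)
    (U : 'M[R]_(n, r)) :
  orthonormal_basis (null_space S) U -> (S : 'M_n) *m X = 0 ->
  X = sym_congr U (sym_congr U^T X).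
Proof.
move=> [UU kerS] SX0.
have PX : U *m U^T *m X = X.
  apply/matrixP => i j.
  have : null_space S (col j X) by rewrite /null_space /= colE mulmxA SX0 mul0mx.
  rewrite kerS => -[w _ Xw].
  have -> : (X : 'M_n) i j = col j X i 0 by rewrite mxE.
  have -> : (U *m U^T *m X) i j = (U *m U^T *m col j X) i 0.
    by rewrite colE mulmxA -colE [RHS]mxE.
  by rewrite -Xw -mulmxA (mulmxA U^T) UU mul1mx.
apply: val_inj => /=; rewrite trmxK !mulmxA PX -mulmxA.
by rewrite -{1}(trmx_symmx X) -{1}PX !trmx_mul trmxK trmx_symmx.
Qed.

Lemma inner_congr_ker (R : realType) (n r : nat) (S : symmx R n)
    (U : 'M[R]_(n, r)) (T : symmx R r) :
  orthonormal_basis (null_space S) U -> inner_symmx S (sym_congr U T) = 0.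
Proof.
move=> [_ kerS]; rewrite /inner_symmx /= !mulmxA.
suff -> : (S : 'M_n) *m U = 0 by rewrite !mul0mx linear0.
apply/matrixP => i j; rewrite [RHS]mxE.
have -> : ((S : 'M_n) *m U) i j =
    ((S : 'M_n) *m (U *m (delta_mx j 0 : 'cV_r))) i 0.
  by rewrite mulmxA -colE [RHS]mxE.
have /= -> : null_space S (U *m delta_mx j 0) by rewrite kerS; exists (delta_mx j 0).
by rewrite mxE.
Qed.

(** * Strong duality of the gauge pair *)

Lemma adjointZ (R : realType) (n m : nat) (A : {linear symmx R n -> 'cV[R]_m})
    (a : R) (y : 'cV[R]_m) : adjoint A (a *: y) = a *: adjoint A y.
Proof.
apply: val_inj; apply/matrixP => i j.
change ((adjoint A (a *: y) : 'M_n) i j = (a *: (adjoint A y : 'M_n)) i j).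
by rewrite [RHS]mxE !mxE /dotv linearZ -scalemxAl [LHS]mxE.
Qed.

(* Weak duality for the pair (Xstar, ystar) gives mu <C, Xstar> >= <b, ystar> >= 1.
   Conversely, dividing a Lagrange dual solution by the common optimal value
   <C, Xstar> yields a point of (GD) with objective at most 1 / <C, Xstar>. *)
Lemma gauge_strong_duality (R : realType) (n m : nat) (C : symmx R n)
    (b : 'cV[R]_m) (A : {linear symmx R n -> 'cV[R]_m})
    (Xstar : symmx R n) (y ystar : 'cV[R]_m) (mu : R) :
  psd C -> dual_optimal C b A y -> zero_duality_gap C b A ->
  gp_optimal C b A Xstar -> gd_optimal C b A ystar ->
  gauge_polar C (adjoint A ystar) = mu%:E ->
  mu * inner_symmx C Xstar = 1 /\ dotv b ystar = 1.
Proof.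
move=> Cpsd yopt nogap /gp_optimal_primal[Xpsd Xopt] [/= b1 _ ymin] muE.
have vE := nogap _ _ Xopt yopt; set v := inner_symmx C Xstar in vE *.
have [mu0 Spsd] := gauge_polar_attained Cpsd muE.
have AX : A Xstar = b by case: Xopt => -[].
have : 0 <= mu * v - dotv b ystar.
  by have := inner_psd_ge0 Spsd Xpsd; rewrite inner_pencil adjointP AX (dotvC ystar).
(* [v] is nonnegative, and [1 <= dotv b ystar <= mu * v] excludes zero. *)
move=> weak; have v0 : 0 < v by have := inner_psd_ge0 Cpsd Xpsd; rewrite -/v; nra.
have muv : mu <= v^-1.
  rewrite -lee_fin -muE; apply: (le_trans (ymin (v^-1 *: y) _)) => /=.
    by rewrite /dotv -scalemxAr mxE -/(dotv b y) -vE mulVf// gt_eqF.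
  apply: ereal_inf_lbound; exists v^-1 => //; split; first by rewrite invr_ge0 ltW.
  rewrite adjointZ -scalerBr.
  by apply: psd_scale; [rewrite invr_ge0 ltW|case: yopt].
have : mu * v <= 1 by rewrite -(mulVf (lt0r_neq0 v0)) ler_pM2r.
(* The chain [1 <= dotv b ystar <= mu * v <= 1] collapses. *)
by move=> mv; split; lra.
Qed.

(** * Recovery of primal solutions from the null space *)

Theorem theorem4p5 (R : realType) (n m : nat)
    (C : symmx R n) (b : 'cV[R]_m) (A : {linear symmx R n -> 'cV[R]_m})
    (C_psd : psd C)
    (primal_solvable : exists X, primal_optimal C b A X)
    (dual_solvable : exists y, dual_optimal C b A y)
    (no_gap : zero_duality_gap C b A)
    (ystar : 'cV[R]_m) (ystar_opt : gd_optimal C b A ystar)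
    (mu : R) (mu_def : gauge_polar C (adjoint A ystar) = mu%:E)
    (r : nat) (U2 : 'M[R]_(n, r))
    (U2_basis :
       orthonormal_basis (null_space (mu *: C - adjoint A ystar : symmx R n)) U2)
    (Xstar : symmx R n) (Xstar_opt : gp_optimal C b A Xstar) :
  [/\ A Xstar = b,
      exists T : symmx R r, psd T /\ Xstar = sym_congr U2 T,
      exists Tstar : symmx R r,
        residual_optimal b A U2 Tstar /\ Xstar = sym_congr U2 Tstar
    & forall Tstar : symmx R r,
        residual_optimal b A U2 Tstar -> gp_optimal C b A (sym_congr U2 Tstar)].
Proof.
have [y yopt] := dual_solvable.
have [muv by1] :=
  gauge_strong_duality C_psd yopt no_gap Xstar_opt ystar_opt mu_def.
have [_ Spsd] := gauge_polar_attained C_psd mu_def.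
have [Xpsd _] := gp_optimal_primal Xstar_opt.
have [/= AX _ Xmin] := Xstar_opt.
have mu0 : mu != 0.
  by apply/eqP => mu0; move: muv; rewrite mu0 mul0r => /eqP; rewrite eq_sym oner_eq0.
have SX0 : inner_symmx (mu *: C - adjoint A ystar) Xstar = 0.
  by rewrite inner_pencil adjointP AX muv dotvC by1 subrr.
have XE := annihilated_congr U2_basis (inner_psd_eq0 Spsd Xpsd SX0).
have Tpsd := psd_congr U2^T Xpsd.
set T := sym_congr U2^T Xstar in XE Tpsd.
have res0 : norm2 (A (sym_congr U2 T) - b) = 0.
  by apply/eqP; rewrite norm2_eq0 -XE AX subrr.
split=> //; first by exists T.
  by exists T; split=> //; split=> //= Z _; rewrite res0 lee_fin; exact: norm2_ge0.
move=> Z [/= Zpsd _ Zmin].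
(* [T] reaches residual zero, so every residual minimizer does, and is therefore feasible. *)
have AZ : A (sym_congr U2 Z) = b.
  apply/eqP; rewrite -subr_eq0 -norm2_eq0 eq_le norm2_ge0 andbT.
  by have := Zmin _ Tpsd; rewrite res0 lee_fin.
have Upsd := psd_congr U2 Zpsd.
(* Orthogonality to the slack matrix makes [mu] times either side equal to 1; cancel [mu]. *)
have val : inner_symmx C (sym_congr U2 Z) = inner_symmx C Xstar.
  apply: (mulfI mu0); rewrite muv; apply/eqP; rewrite -subr_eq0.
  by rewrite -(inner_congr_ker Z U2_basis) inner_pencil adjointP AZ dotvC by1.
split=> //=; first by rewrite gauge_psd.
by move=> X /Xmin; rewrite (gauge_psd C Upsd) val (gauge_psd C Xpsd).
Qed.
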